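(* Let $\varepsilon>0$ be any constant. No (possibly randomized) online algorithm for the cardinality model is $(1/2+\varepsilon)$-competitive. Moreover, even if the objective function is restricted to be monotone, no randomized online algorithm for the cardinality model is $(3/4+\varepsilon)$-competitive, and no deterministic online algorithm for the cardinality model is $(1/2+\varepsilon)$-competitive.
   Context: The cardinality model: there is an unknown finite ground set $\mathcal N=\{u_1,\dots,u_n\}$, a non-negative submodular function $f:2^{\mathcal N}\to\mathbb R_{\ge0}$ (not necessarily monotone), and a parameter $0\le k\le n$ known to the algorithm. A set $S\subseteq\mathcal N$ is feasible if and only if $|S|\le k$. The elements are revealed one by one in the order $u_1,\dots,u_n$, chosen by an adversary. The algorithm does not know $n$ in advance. It maintains feasible solutions $S_0=\varnothing,S_1,\dots,S_n$, where immediately after $u_i$ is revealed it chooses $S_i$ to be any feasible subset of $S_{i-1}\cup\{u_i\}$. The choice may depend only on the values of $f$ on subsets of $\{u_1,\dots,u_i\}$ (accessed through a value oracle), the past, and, for randomized algorithms, internal randomness; elements carry no information other than their arrival position and these values. The computational power of the algorithm is not restricted. The algorithm is $\alpha$-competitive if $\mathbb E[f(S_n)]\ge\alpha\cdot\max\{f(S): S\subseteq\mathcal N,\ |S|\le k\}$ for every instance (every $\mathcal N$, $f$, $k$ and revelation order). The instance is fixed independently of the outcome of the algorithm's random choices, but may depend on the algorithm. $f$ is monotone if $A\subseteq B\subseteq \mathcal N$ implies $f(A)\le f(B)$. *)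

(* Defs.v *)
From mathcomp Require Import all_boot all_order all_algebra.
From mathcomp Require Import all_classical all_reals all_analysis.

Set Implicit Arguments.
Unset Strict Implicit.
Unset Printing Implicit Defensive.

Import Order.TTheory GRing.Theory Num.Theory.
Local Open Scope ring_scope.

(* Elements carry no information besides their arrival position, so the ground
   set of an instance with n elements is 'I_n listed in arrival order (arrival
   positions are counted from 0). *)
Definition objective (R : realType) (n : nat) := {ffun {set 'I_n} -> R}.

Definition nonnegative (R : realType) (n : nat) (f : objective R n) : Prop :=
  forall A : {set 'I_n}, 0 <= f A.

Definition submodular (R : realType) (n : nat) (f : objective R n) : Prop :=
  forall A B : {set 'I_n}, f (A :|: B) + f (A :&: B) <= f A + f B.

Definition monotone (R : realType) (n : nat) (f : objective R n) : Prop :=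
  forall A B : {set 'I_n}, A \subset B -> f A <= f B.

Definition objective_class (R : realType) := forall n, objective R n -> Prop.

Definition submodular_class (R : realType) : objective_class R :=
  fun n f => nonnegative f /\ submodular f.

Definition monotone_class (R : realType) : objective_class R :=
  fun n f => [/\ nonnegative f, submodular f & monotone f].

Definition widen_set (i n : nat) (le_in : (i <= n)%N) (A : {set 'I_i}) :
  {set 'I_n} := [set widen_ord le_in x | x in A].

(* The values of f on the subsets of the first i elements: everything the value
   oracle can tell once exactly i elements have been revealed. *)
Definition revealed (R : realType) (i n : nat) (le_in : (i <= n)%N)
  (f : objective R n) : objective R i := [ffun A => f (widen_set le_in A)].

(* The solutions (S_1, ..., S_i). *)
Fixpoint history (i : nat) : Type :=
  match i with
  | 0 => unit
  | j.+1 => (history j * {set 'I_j.+1})%type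
  end.

Definition current (i : nat) : history i -> {set 'I_i} :=
  match i with
  | 0 => fun _ => finset.set0
  | j.+1 => fun h => h.2
  end.

(* A step receives k, the number i of previously revealed elements, the values
   of f on the subsets of the first i.+1 elements, and (S_1, ..., S_i); it
   returns S_(i.+1).  The number n of elements is not available to it. *)
Definition online_algorithm (R : realType) :=
  forall (k i : nat), objective R i.+1 -> history i -> {set 'I_i.+1}.

Fixpoint run (R : realType) (A : online_algorithm R) (k i : nat) :
  objective R i -> history i :=
  match i with
  | 0 => fun _ => tt
  | j.+1 => fun v =>
      let h := run A k (revealed (leqnSn j) v) in (h, A k j v h)
  end.

(* S_i on every instance whose objective function has the values v on the
   subsets of the first i elements. *)
Definition solution (R : realType) (A : online_algorithm R) (k i : nat)
  (v : objective R i) : {set 'I_i} := current (run A k v).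

(* ord_max : 'I_i.+1 is the newly revealed element. *)
Definition obeys_rules (R : realType) (A : online_algorithm R) (k n : nat)
  (f : objective R n) : Prop :=
  forall (i : nat) (lt_in : (i < n)%N),
    solution A k (revealed lt_in f)
      \subset ord_max |: widen_set (leqnSn i)
                           (solution A k (revealed (ltnW lt_in) f))
    /\ (#|solution A k (revealed lt_in f)| <= k)%N.

(* The default value is the value of a feasible set, so this is the maximum. *)
Definition opt (R : realType) (k n : nat) (f : objective R n) : R :=
  \big[Num.max/f finset.set0]_(A : {set 'I_n} | (#|A| <= k)%N) f A.

Definition deterministic_algorithm (R : realType) (C : objective_class R)
  (A : online_algorithm R) : Prop :=
  forall (n k : nat) (f : objective R n), (k <= n)%N -> C n f ->
    obeys_rules A k f.

Definition deterministic_competitive (R : realType) (C : objective_class R)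
  (A : online_algorithm R) (alpha : R) : Prop :=
  forall (n k : nat) (f : objective R n), (k <= n)%N -> C n f ->
    alpha * opt k f <= f (solution A k f).

(* A randomized algorithm is a family of deterministic ones indexed by the
   outcome w of its internal randomness, such that every S_i is a random
   variable. *)
Definition randomized_algorithm (R : realType) (C : objective_class R)
  (d : measure_display) (T : measurableType d) (A : T -> online_algorithm R) :
  Prop :=
  forall (n k : nat) (f : objective R n), (k <= n)%N -> C n f ->
    (forall w, obeys_rules (A w) k f) /\
    (forall (i : nat) (le_in : (i <= n)%N) (S : {set 'I_i}),
       measurable [set w | solution (A w) k (revealed le_in f) = S]%classic).

Definition randomized_competitive (R : realType) (C : objective_class R)
  (d : measure_display) (T : measurableType d) (P : probability T R)
  (A : T -> online_algorithm R) (alpha : R) : Prop :=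
  forall (n k : nat) (f : objective R n), (k <= n)%N -> C n f ->
    ((alpha * opt k f)%:E <= 'E_P[fun w => f (solution (A w) k f)])%E.

(* Main.v *)
Require Import Defs.
From mathcomp Require Import all_boot all_order all_algebra.
From mathcomp Require Import all_classical all_reals all_analysis.
From mathcomp Require Import measurable_realfun zify lra.

(** All three bounds come from one family of objectives on M items followed by a
    last element v.  As long as v is absent a set A is worth #|A|, so the items
    are indistinguishable; a hidden set O of k items is disclosed only by v, and
    a set A containing v is worth k + #|A :&: O|.  The optimum is at least
    2k - 1 (v and k - 1 items of O), whereas an algorithm that held the items S
    before v was revealed ends with at most k + #|S :&: O|.
    A deterministic algorithm leaves k out of 2k items, which O may consist of.
    Against a randomized algorithm, let O be a uniformly random block among m
    disjoint blocks of k items: the average of #|S :&: O| is at most k / m.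
    Large m gives the ratio 1/2; for m = 2 the objective is monotone, since only
    k items lie outside O, and the ratio is 3/4. *)

Import Order.TTheory GRing.Theory Num.Theory.
Local Open Scope ring_scope.

(** * Revealed values, and the hidden objective and its class *)

Lemma widen_setE {i n : nat} (le_in : (i <= n)%N) (A : {set 'I_i}) (x : 'I_i) :
  (widen_ord le_in x \in widen_set le_in A) = (x \in A).
Proof.
by rewrite /widen_set mem_imset // => y z /(congr1 val) /= /val_inj.
Qed.

Lemma revealed_id (R : realType) (n : nat) (le_nn : (n <= n)%N)
  (f : objective R n) : revealed le_nn f = f.
Proof.
apply/ffunP => A; rewrite ffunE; congr (f _).
apply/setP => x; rewrite -[RHS](widen_setE le_nn).
by have -> : widen_ord le_nn x = x by exact/val_inj.
Qed.

Definition old_items {M : nat} (A : {set 'I_M.+1}) : {set 'I_M} :=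
  finset (fun i => widen_ord (leqnSn M) i \in A).

Definition hidden_objective (R : realType) {M : nat} (k : nat)
  (O : {set 'I_M}) : objective R M.+1 :=
  [ffun A : {set _} => (if ord_max \in A then (k + #|old_items A :&: O|)%N
              else #|old_items A|)%:R].

Lemma old_items_widen {M : nat} (A : {set 'I_M}) :
  old_items (widen_set (leqnSn M) A) = A.
Proof. by apply/setP => i; rewrite inE widen_setE. Qed.

Lemma ord_max_widen_set {M : nat} (A : {set 'I_M}) :
  ord_max \notin widen_set (leqnSn M) A.
Proof.
apply/imsetP => -[x _ /(congr1 val) /= eqMx].
by have := ltn_ord x; rewrite -eqMx ltnn.
Qed.

Lemma old_itemsU {M : nat} (A B : {set 'I_M.+1}) :
  old_items (A :|: B) = old_items A :|: old_items B.
Proof. by apply/setP => i; rewrite !inE. Qed.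

Lemma old_itemsI {M : nat} (A B : {set 'I_M.+1}) :
  old_items (A :&: B) = old_items A :&: old_items B.
Proof. by apply/setP => i; rewrite !inE. Qed.

Lemma old_itemsS {M : nat} {A B : {set 'I_M.+1}} :
  A \subset B -> old_items A \subset old_items B.
Proof.
move=> /fintype.subsetP sAB; apply/fintype.subsetP => i.
by rewrite !inE => /sAB.
Qed.

Lemma card_old_items {M : nat} (A : {set 'I_M.+1}) : (#|old_items A| <= #|A|)%N.
Proof.
rewrite -(card_imset (mem (old_items A)) (f := widen_ord (leqnSn M)));
  last first.
  by move=> y z /(congr1 val) /= /val_inj.
by apply/subset_leq_card/fintype.subsetP => _ /imsetP[i + ->]; rewrite inE.
Qed.

(** [O] is absent from the right-hand side: before the last arrival, all choices of [O] look alike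
    to the algorithm. *)
Lemma revealed_hidden_objective (R : realType) (M k : nat) (O : {set 'I_M}) :
  revealed (leqnSn M) (hidden_objective R k O) =
    [ffun A : {set 'I_M} => #|A|%:R].
Proof.
apply/ffunP => A.
by rewrite !ffunE (negbTE (ord_max_widen_set A)) old_items_widen.
Qed.

(** Inside [O] cardinality is modular, and outside [O] the set [A :&: B] has no more elements than
    [B]. This is the case of submodularity where only [A] comes with the last element. *)
Lemma cardUI_mixed {T : finType} (A B O : {set T}) :
  (#|(A :|: B) :&: O| + #|A :&: B| <= #|A :&: O| + #|B|)%N.
Proof.
have := cardsUI (A :&: O) (B :&: O).
rewrite -finset.setIUl -finset.setIIl.
have := cardsID O (A :&: B); have := cardsID O B.
have /subset_leq_card : (A :&: B) :\: O \subset B :\: O.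
  exact: finset.setSD (finset.subsetIr A B).
lia.
Qed.

Lemma hidden_objective_submodular (R : realType) (M k : nat) (O : {set 'I_M}) :
  submodular_class (hidden_objective R k O).
Proof.
split=> [A|A B]; first by rewrite ffunE.
rewrite !ffunE -!natrD ler_nat old_itemsU old_itemsI !inE.
case: (ord_max \in A); case: (ord_max \in B) => /=.
- rewrite [leqLHS]addnACA [leqRHS]addnACA leq_add2l.
  by rewrite finset.setIUl finset.setIIl cardsUI.
- by rewrite -!addnA leq_add2l cardUI_mixed.
- rewrite -addnA [leqRHS]addnCA leq_add2l [leqRHS]addnC finset.setUC.
  by rewrite (finset.setIC (old_items A)) cardUI_mixed.
- by rewrite cardsUI.
Qed.

(** Adding the last element forfeits only the items outside [O]; they number at most [k], which the
    bonus [k] makes up for. *)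
Lemma hidden_objective_monotone (R : realType) (M k : nat) (O : {set 'I_M}) :
  (#|~: O| <= k)%N -> monotone_class (hidden_objective R k O).
Proof.
have [f_ge0 f_sub] := hidden_objective_submodular R M k O.
move=> cardO; split=> // A B sAB; rewrite !ffunE ler_nat.
have sAB' := old_itemsS sAB; have := subset_leq_card sAB'.
have := subset_leq_card (finset.setSI O sAB').
case: ifPn => [/(fintype.subsetP sAB) -> | _]; first lia.
case: ifP => _ //; have := cardsID O (old_items A).
have : (#|old_items A :\: O| <= #|~: O|)%N.
  by apply: subset_leq_card; rewrite finset.setDE; exact: finset.subsetIr.
lia.
Qed.

(** * The optimum against the online value *)

Lemma opt_hidden_objective (R : realType) (M k : nat) (O : {set 'I_M}) :
  (0 < k)%N -> #|O| = k -> 2 * k%:R - 1 <= opt k (hidden_objective R k O).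
Proof.
(* The item [x] is dropped from [O] to make room for the last element. *)
move=> k_gt0 cardO; have /card_gt0P[x Ox] : (0 < #|O|)%N by rewrite cardO.
pose B := O :\ x; have cardB : #|B| = k.-1.
  by have := cardsD1 x O; rewrite Ox cardO -/B; lia.
pose A := ord_max |: widen_set (leqnSn M) B.
have A_old : old_items A = B.
  rewrite old_itemsU old_items_widen; apply/setP => i; rewrite !inE.
  by rewrite -val_eqE /= ltn_eqF.
have cardA : (#|A| <= k)%N.
  rewrite cardsU1 ord_max_widen_set card_imset ?cardB; first by lia.
  by move=> y z /(congr1 val) /= /val_inj.
apply: le_trans (le_bigmax_cond _ _ cardA).
rewrite ffunE A_old setU11 (finset.setIidPl _) ?subD1set // cardB natrD.
by rewrite -subn1 natrB //; lra.
Qed.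

Lemma card_solution_revealed {R : realType} {A : online_algorithm R} {k M : nat}
  {f : objective R M.+1} :
  obeys_rules A k f -> (#|solution A k (revealed (leqnSn M) f)| <= k)%N.
Proof.
(* The rules bound only solutions chosen after an arrival, so the empty initial solution is treated
   apart. *)
case: M f => [|M] f rules; first by rewrite /solution /= finset.cards0.
by have [_] := rules M (leqnSn M.+1).
Qed.

(** The last step can only discard items of the earlier solution and add the last element. That
    earlier solution is computed from cardinalities alone, hence independent of [O]. *)
Lemma hidden_objective_solution {R : realType} {M k : nat} {O : {set 'I_M}}
  {A : online_algorithm R} :
  obeys_rules A k (hidden_objective R k O) ->
  hidden_objective R k O (solution A k (hidden_objective R k O)) <=
    (k + #|solution A k [ffun B : {set 'I_M} => #|B|%:R] :&: O|)%N%:R.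
Proof.
move=> rules; have := rules M (ltnSn M).
rewrite revealed_id (bool_irrelevance (ltnW _) (leqnSn M)).
rewrite revealed_hidden_objective.
set S := solution A k [ffun B : {set 'I_M} => _].
set S' := solution A k _ => -[sS' cardS'].
have sS : old_items S' \subset S.
  apply: fintype.subset_trans (old_itemsS sS') _; apply/fintype.subsetP => i.
  by rewrite !inE widen_setE -val_eqE /= ltn_eqF.
rewrite ffunE ler_nat; case: ifP => _.
  by rewrite leq_add2l; exact/subset_leq_card/finset.setSI.
(* Without the last element, feasibility caps the value at [k]. *)
exact: leq_trans (leq_trans (card_old_items _) cardS') (leq_addr _ _).
Qed.

(** * Disjoint blocks of items *)

Definition block (m k : nat) (j : 'I_m) : {set 'I_(m * k)} :=
  finset (fun i : 'I_(m * k) => (i %/ k)%N == j).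

Lemma sum_card_block {m k : nat} (S : {set 'I_(m * k)}) :
  (\sum_(j < m) #|S :&: block m k j| <= #|S|)%N.
Proof.
under eq_bigr => j _ do rewrite -sum1_card.
rewrite (exchange_big_dep (mem S)); last by move=> j i _ /finset.setIP[].
rewrite -[leqRHS]sum1_card; apply: leq_sum => i Si; rewrite sum1_card.
have blockP j : i \in S :&: block m k j -> (i %/ k)%N = j.
  by case/finset.setIP=> _; rewrite inE => /eqP.
apply/card_le1_eqP => j j' /blockP ij /blockP ij'.
by apply: val_inj; rewrite /= -ij -ij'.
Qed.

Lemma card_block_ge (m k : nat) (j : 'I_m) : (k <= #|block m k j|)%N.
Proof.
case: k => // k; have lt_mk (r : 'I_k.+1) : (j * k.+1 + r < m * k.+1)%N.
  by have := ltn_ord j; have := ltn_ord r; nia.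
pose g (r : 'I_k.+1) := Ordinal (lt_mk r).
have g_inj : injective g by move=> r s /(congr1 val) /= /addnI /val_inj.
rewrite -[leqLHS]card_ord -(card_imset predT g_inj).
apply/subset_leq_card/fintype.subsetP => _ /imsetP[r _ ->].
by rewrite inE /= divnMDl // divn_small ?addn0.
Qed.

Lemma card_block (m k : nat) (j : 'I_m) : #|block m k j| = k.
Proof.
apply/eqP; rewrite eqn_leq card_block_ge andbT.
(* The other [m.-1] blocks are disjoint from this one and take up at least [k] items each, which
   leaves at most [k]. *)
suff : (#|block m k j| + m.-1 * k <= m * k)%N by have := ltn_ord j; nia.
rewrite -[leqRHS]card_ord -cardsT; apply: leq_trans (sum_card_block _).
rewrite (bigD1 j) //= finset.setTI leq_add2l.
apply: (@leq_trans (\sum_(i in predC1 j) k)).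
  by rewrite sum_nat_const cardC1 card_ord.
by apply: leq_sum => i _; rewrite finset.setTI card_block_ge.
Qed.

(** * Averaging over the blocks, and the deterministic bound *)

Lemma measurable_fun_fin_fibers {d : measure_display} {T : measurableType d}
  {R : realType} {F : finType} (X : T -> F) (g : F -> R) :
  (forall s, measurable [set w | X w = s]%classic) ->
  measurable_fun setT (g \o X).
Proof.
move=> mX _ Y mY; rewrite setTI.
have -> : ((g \o X) @^-1` Y =
           \bigcup_(s in [set s | Y (g s)]) [set w | X w = s])%classic.
  by apply/seteqP; split=> [w Yw|w [s /= Ys ->]] //; exists (X w).
by apply: fin_bigcup_measurable => [|s _]; [exact: finite_finset | exact: mX].
Qed.

(** The random block is replaced by a sum over all blocks. For each outcome [w] the solution before
    the last arrival is the same for every block, so the sum of values is bounded pointwise;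
    integrating it bounds the sum of the competitive guarantees. *)
Lemma randomized_block_bound (R : realType) (C : objective_class R)
  (d : measure_display) (T : measurableType d) (P : probability T R)
  (A : T -> online_algorithm R) (alpha : R) (m k : nat) :
  0 <= alpha -> (0 < m)%N -> (0 < k)%N ->
  (forall j, C (m * k).+1 (hidden_objective R k (block m k j))) ->
  randomized_algorithm C A -> randomized_competitive C P A alpha ->
  m%:R * (alpha * (2 * k%:R - 1)) <= m%:R * k%:R + k%:R.
Proof.
move=> alpha_ge0 m_gt0 k_gt0 C_hidden algA compA.
have le_kn : (k <= (m * k).+1)%N by nia.
pose f j := hidden_objective R k (block m k j).
pose X j w := f j (solution (A w) k (f j)).
have X_ge0 j w : 0 <= X j w by rewrite /X /f ffunE.
have mX j : measurable_fun setT (X j).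
  pose Sol w := solution (A w) k (f j).
  apply: (measurable_fun_fin_fibers Sol (f j)) => S.
  have [_ /(_ _ (leqnn _) S)] := algA _ _ _ le_kn (C_hidden j).
  by rewrite revealed_id.
have sumX w : \sum_(j < m) X j w <= m%:R * k%:R + k%:R.
  have rules j : obeys_rules (A w) k (f j).
    by have [] := algA _ _ _ le_kn (C_hidden j).
  set S := solution (A w) k [ffun B : {set 'I_(m * k)} => #|B|%:R].
  have cardS : (#|S| <= k)%N.
    have := card_solution_revealed (rules (Ordinal m_gt0)).
    by rewrite revealed_hidden_objective.
  apply: (@le_trans _ _ (\sum_(j < m) (k + #|S :&: block m k j|)%N%:R)).
    apply: ler_sum => j _; exact: (hidden_objective_solution (rules j)).
  rewrite -natr_sum -natrM -natrD ler_nat big_split /= sum_nat_const card_ord.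
  by rewrite leq_add2l (leq_trans (sum_card_block S)).
rewrite -lee_fin.
apply: (@le_trans _ _ (\sum_(j < m) 'E_P[X j])%E).
  rewrite mulr_natl -[leLHS]/((_ *+ m)%:E) -[in leLHS](card_ord m) -sumr_const.
  rewrite -sumEFin; apply: lee_sum => j _.
  apply: le_trans (compA _ _ _ le_kn (C_hidden j)).
  rewrite lee_fin ler_wpM2l // opt_hidden_objective //; exact: card_block.
under eq_bigr => j _ do rewrite unlock.
rewrite -ge0_integral_sum //=; last 2 first.
- by move=> j; apply/measurable_EFinP; exact: mX.
- by move=> j w _; rewrite lee_fin.
apply: (@le_trans _ _ 'E_P[cst (m%:R * k%:R + k%:R)%R]%E).
  rewrite [in leRHS]unlock; apply: ge0_le_integral => //=.
  - by move=> w _; apply: sume_ge0 => j _; rewrite lee_fin.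
  - by apply: emeasurable_sum => j; apply/measurable_EFinP; exact: mX.
  - by move=> w _; rewrite sumEFin lee_fin.
by rewrite expectation_cst.
Qed.

Lemma deterministic_bound (R : realType) (A : online_algorithm R) (alpha : R)
  (k : nat) :
  0 <= alpha -> (0 < k)%N ->
  deterministic_algorithm (monotone_class (R:=R)) A ->
  deterministic_competitive (monotone_class (R:=R)) A alpha ->
  alpha * (2 * k%:R - 1) <= k%:R.
Proof.
move=> alpha_ge0 k_gt0 algA compA.
have le_kn : (k <= (2 * k).+1)%N by lia.
have monoO (O : {set 'I_(2 * k)}) : #|O| = k ->
    monotone_class (hidden_objective R k O).
  move=> cardO; apply: hidden_objective_monotone.
  by have := cardsC O; rewrite card_ord cardO; lia.
set S := solution A k [ffun B : {set 'I_(2 * k)} => #|B|%:R].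
have cardS : (#|S| <= k)%N.
  (* Any [k] items would do in place of this block: [S] is the same for all of them. *)
  have := card_solution_revealed
    (algA _ _ _ le_kn (monoO _ (card_block 2 k ord0))).
  by rewrite revealed_hidden_objective.
have : (k <= #|~: S|)%N by have := cardsC S; rewrite card_ord; lia.
case/card_geqP=> s [uniq_s size_s sub_s].
pose O := [set:: s].
have cardO : #|O| = k by rewrite cardsE (card_uniqP uniq_s).
have SO : S :&: O = finset.set0.
  apply/setP => i; rewrite !inE; apply/negbTE/negP => /andP[Si /sub_s].
  by rewrite inE Si.
have monof := monoO O cardO.
apply: le_trans (_ : alpha * opt k (hidden_objective R k O) <= _).
  by rewrite ler_wpM2l // opt_hidden_objective.
apply: le_trans (compA _ _ _ le_kn monof) _.
apply: le_trans (hidden_objective_solution (algA _ _ _ le_kn monof)) _.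
by rewrite SO finset.cards0 addn0.
Qed.

Theorem theorem1p6 (R : realType) (eps : R) (eps_gt0 : 0 < eps) :
  (forall (d : measure_display) (T : measurableType d) (P : probability T R)
          (A : T -> online_algorithm R),
     randomized_algorithm (submodular_class (R:=R)) A ->
     ~ randomized_competitive (submodular_class (R:=R)) P A (1 / 2 + eps))
  /\
  (forall (d : measure_display) (T : measurableType d) (P : probability T R)
          (A : T -> online_algorithm R),
     randomized_algorithm (monotone_class (R:=R)) A ->
     ~ randomized_competitive (monotone_class (R:=R)) P A (3 / 4 + eps))
  /\
  (forall A : online_algorithm R,
     deterministic_algorithm (monotone_class (R:=R)) A ->
     ~ deterministic_competitive (monotone_class (R:=R)) A (1 / 2 + eps)).
Proof.
(* Chosen so that [k - 1] exceeds [1 / eps]; this absorbs the loss of 1 in the optimum and the term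
   [k / m] for [m = k]. *)
pose k := (Num.truncn (eps^-1)).+2.
have k_large : 1 + eps <= eps * k%:R.
  have := truncnS_gt (eps^-1); rewrite -(ltr_pM2l eps_gt0) mulfV ?gt_eqF //.
  by rewrite /k -[_.+2]addn1 natrD mulrDr mulr1 => /ltW; lra.
split; [|split].
- move=> d T P A algA compA.
  (* With [m = k], the bound divided by [k] says [eps * (2k - 1) <= 3/2], but [k_large] makes the
     left side at least [2 + eps]. *)
  have := @randomized_block_bound R _ d T P A _ k k _ _ _ _ algA compA.
  move=> /(_ ltac:(lra) isT isT (fun j => hidden_objective_submodular _ _ _ _)).
  have k_ge0 : 0 < k%:R :> R by rewrite ltr0n.
  nra.
- move=> d T P A algA compA.
  have monof j : monotone_class (hidden_objective R k (block 2 k j)).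
    apply: hidden_objective_monotone.
    by have := cardsC (block 2 k j); rewrite card_ord card_block; lia.
  (* Two blocks give [eps * (2k - 1) <= 3/4], again against [k_large]. *)
  have := @randomized_block_bound R _ d T P A _ 2 k _ _ _ monof algA compA.
  by move=> /(_ ltac:(lra) isT isT); lra.
- move=> A algA compA.
  have := deterministic_bound R A _ k _ isT algA compA.
  by move=> /(_ ltac:(lra)); lra.
Qed.
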